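(* For every three integers $q\ge -1$, $k\ge 2q+6$ and $n\ge k$, we have $$\mathrm{ex}(n,\mathcal{H}^{(2)}(k,q)) < C\cdot n^{1+\frac{1}{\lfloor k/(q+3)\rfloor}}+(q+2)n,$$ where $C=(q+2)^{\frac{1}{\lfloor k/(q+3)\rfloor}}$.
   Context: Graphs are finite and simple (no loops, no multiple edges); isolated vertices are allowed. $V(H)$ and $E(H)$ denote the vertex and edge sets of $H$. Subgraphs are not necessarily induced. For a family $\mathcal{F}$ of graphs, a graph is $\mathcal{F}$-free if it has no subgraph isomorphic to a member of $\mathcal{F}$, and $\mathrm{ex}(n,\mathcal{F})$ is the maximum number of edges in an $\mathcal{F}$-free graph on $n$ vertices. For integers $q\ge -1$ and $k\ge q+3$, $\mathcal{H}^{(2)}(k,q)$ is the family of all graphs $H$ with $|E(H)|-|V(H)|=q+1$ and $q+3\le |E(H)|\le k$. *)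

(* Defs.v *)
From HB Require Import structures.
From mathcomp Require Import all_boot all_order all_algebra.
From mathcomp Require Import all_classical all_reals all_analysis.

Set Implicit Arguments.
Unset Strict Implicit.
Unset Printing Implicit Defensive.

Import Order.TTheory GRing.Theory Num.Theory.
Local Open Scope ring_scope.

(* Finite simple graphs whose vertices are drawn from an ambient finite type,
   so that a subgraph may have fewer vertices than the graph containing it.
   An edge is a two-element set of vertices. *)
Record graph (T : finType) := Graph {
  vset : {set T};
  eset : {set {set T}};
  esetP : forall e : {set T}, e \in eset -> #|e| = 2%N /\ e \subset vset
}.

Definition subgraph (T : finType) (K G : graph T) : Prop :=
  vset K \subset vset G /\ eset K \subset eset G.

(* Only the vertices of the graphs matter, not the unused elements of the
   ambient types, so the bijection is between the subtypes they span. *)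
Definition isomorphic (T U : finType) (H : graph T) (K : graph U) : Prop :=
  exists f : {x : T | x \in vset H} -> {y : U | y \in vset K},
    bijective f /\
    forall x y, ([set val x; val y] \in eset H)
              = ([set val (f x); val (f y)] \in eset K).

Definition graph_family := forall T : finType, graph T -> Prop.

Definition free_of (F : graph_family) (T : finType) (G : graph T) : Prop :=
  forall (U : finType) (H : graph U), F U H ->
    ~ exists K : graph T, subgraph K G /\ isomorphic H K.

Definition free_size (F : graph_family) (n m : nat) : Prop :=
  exists (T : finType) (G : graph T),
    [/\ #|vset G| = n, #|eset G| = m & free_of F G].

(* A graph on n vertices has at most 'C(n, 2) edges, so the range of m loses
   nothing (see extremal_max). The value is 0 if no graph on n vertices avoids
   F. *)
Definition extremal (n : nat) (F : graph_family) : nat :=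
  (\max_(m < 'C(n, 2).+1 | `[< free_size F n m >]) m)%N.

Definition H2 (k q : int) : graph_family := fun T H =>
  [/\ #|eset H|%:Z - #|vset H|%:Z = q + 1,
      q + 3 <= #|eset H|%:Z
    & #|eset H|%:Z <= k].

Lemma card_eset (T : finType) (G : graph T) :
  (#|eset G| <= 'C(#|vset G|, 2))%N.
Proof.
rewrite -cards_draws; apply/subset_leq_card/fintype.subsetP => e /esetP [e2 eV].
by rewrite inE eV e2 eqxx.
Qed.

Lemma extremal_max (F : graph_family) (n m : nat) :
  free_size F n m -> (m <= extremal n F)%N.
Proof.
move=> Fm; have [T [G [GV GE _]]] := Fm.
have ltm : (m < 'C(n, 2).+1)%N by rewrite ltnS -GV -GE card_eset.
by apply: (leq_bigmax_cond (Ordinal ltm)); apply/asboolP.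
Qed.

Lemma extremal_attained (F : graph_family) (n m : nat) :
  free_size F n m -> free_size F n (extremal n F).
Proof.
move=> Fm; have [T [G [GV GE _]]] := Fm.
have ltm : (m < 'C(n, 2).+1)%N by rewrite ltnS -GV -GE card_eset.
have Pm : `[< free_size F n (Ordinal ltm) >] by apply/asboolP.
by rewrite /extremal (bigop.bigmax_eq_arg (Ordinal ltm) Pm); case: arg_maxnP => // i /asboolP.
Qed.

(* Main.v *)
Require Import Defs.
From mathcomp Require Import zify.
From mathcomp Require Import all_boot all_order all_algebra.
From mathcomp Require Import all_classical all_reals all_analysis.

Set Implicit Arguments.
Unset Strict Implicit.
Unset Printing Implicit Defensive.

Import mathcomp.boot.fintype mathcomp.boot.finset.
Import Order.TTheory GRing.Theory Num.Theory.

(** Write p = q + 2 and t = k %/ (q + 3), so that t (p + 1) <= k and the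
    forbidden graphs are those with at most k edges and exactly p - 1 more edges
    than vertices (they automatically have more than p edges as soon as they have
    two vertices).

    A graph with more than (D + p) n edges contains a nonempty set S of vertices
    inducing minimum degree at least D + 1 + p ([min_degree_subset]).  Explore S
    by breadth-first search from a vertex r.  Call a neighbour y of w a non-tree
    neighbour if wy is not an edge of the search tree.  Suppose that a vertex w of
    depth at most t has p non-tree neighbours of depth less than t.  The tree
    paths from the root to w and to these neighbours have at most
    t + p (t - 1) edges; they span a tree, which has one vertex more than edges,
    and the p additional edges at w turn it into a subgraph with excess p - 1 and
    at most t + p (t - 1) + p = t (p + 1) edges ([nontree_subgraph]): a forbidden
    subgraph.

    So in a graph without forbidden subgraphs, a vertex of depth less than t
    sends all but p of its neighbours, its parent and its non-tree ones, to new
    vertices of the next layer.  Up to depth t - 1 each vertex is new for only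
    one parent, so layers grow by a factor D + 1, which is the D of
    [layer_growth].  A vertex of depth t is reached at most p times, so the last
    layer has at least (D + 1)^t / p vertices ([last_layer_growth]).  As the root
    is not among them, (D + 1)^t < p n ([layers_bound]).

    Hence the extremal number is at most (D + p) n for every D with
    p n <= (D + 1)^t ([sparse_of_free]).  The least such D satisfies D^t < p n,
    that is D < (p n)^(1/t), and this yields the strict inequality, since
    C n^(1 + 1/t) = (p n)^(1/t) n. *)

(** * Neighbourhoods and minimum degree *)

Definition nbr (T : finType) (G : graph T) (S : {set T}) (x : T) : {set T} :=
  [set y in S | [set x; y] \in eset G].

Lemma nbr_sym (T : finType) (G : graph T) (S : {set T}) (x y : T) :
  x \in S -> y \in nbr G S x -> x \in nbr G S y.
Proof. by move=> xS; rewrite !inE xS setUC => /andP[]. Qed.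

Lemma nbr_irrefl (T : finType) (G : graph T) (S : {set T}) (x : T) :
  x \notin nbr G S x.
Proof.
by rewrite inE setUid; apply/negP => /andP[_ /esetP[]]; rewrite cards1.
Qed.

(** A minimal set S spanning more than d edges per vertex works: by minimality,
    removing one vertex of S must destroy more than d edges.  Such an S is
    nonempty because the inequality is strict. *)
Lemma min_degree_subset (T : finType) (G : graph T) (d : nat) :
  d * #|vset G| < #|eset G| ->
  exists S : {set T}, [/\ S \subset vset G, S != set0
    & forall x, x \in S -> d < #|nbr G S x|].
Proof.
move=> dense; pose eS (S : {set T}) := [set e in eset G | e \subset S].
pose P (S : {set T}) := (S \subset vset G) && (d * #|S| < #|eS S|).
have PV : P (vset G).
  rewrite /P subxx (leq_trans dense) //; apply/subset_leq_card/subsetP.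
  by move=> e eG; rewrite inE eG; have [] := esetP eG.
case: (@arg_minnP _ (vset G) P (fun S : {set T} => #|S|) PV) => S /andP[SV dS] Smin.
exists S; split => //.
  apply: contraTneq dS => ->; rewrite cards0 muln0 -leqNgt leqn0 cards_eq0.
  apply/eqP/setP => e; rewrite !inE subset0; apply/negP => /andP[eG /eqP e0].
  by have [] := esetP eG; rewrite e0 cards0.
move=> x xS; rewrite ltnNge; apply/negP => degx.
have eS_sub : eS S \subset eS (S :\ x) :|: [set [set x; y] | y in nbr G S x].
  apply/subsetP => e; rewrite !inE => /andP[eG eSS].
  have [xe|xe] := boolP (x \in e); last by rewrite eG subsetD1 eSS xe.
  apply/orP; right.
  have [/eqP/cards2P[a [b] [ab eab]] _] := esetP eG.
  have [y ey] : exists y, e = [set x; y].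
    move: xe; rewrite eab !inE => /orP[] /eqP ->; first by exists b.
    by exists a; rewrite setUC.
  apply/imsetP; exists y => //; rewrite inE -ey eG andbT.
  by apply: (subsetP eSS); rewrite ey !inE eqxx orbT.
have /Smin : P (S :\ x).
  rewrite /P (subset_trans (subD1set _ _) SV) /=.
  move: dS; rewrite (cardsD1 x S) xS mulnS => dS.
  rewrite -(ltn_add2l d); apply: leq_trans dS _.
  rewrite addnC; apply: leq_trans (subset_leq_card eS_sub) _.
  apply: leq_trans (leq_card_setU _ _) _; rewrite leq_add2l.
  exact: leq_trans (leq_imset_card _ _) degx.
by rewrite (cardsD1 x S) xS ltnn.
Qed.

(** * Breadth-first search *)

(** The outcome of a breadth-first search from r along the neighbourhoods N,
    stopped at depth t: d is the depth and par the parent.  Every depth above t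
    means out of reach, and there par is arbitrary.  The root is its own parent,
    which makes sets of ancestors closed under par. *)
Record layering (T : finType) (N : T -> {set T}) (r : T) (t : nat)
    (d : T -> nat) (par : T -> T) : Prop := Layering {
  depth_root : d r = 0;
  depth_eq0 : forall x, d x = 0 -> x = r;
  par_root : par r = r;
  depth_step : forall x y, d x <= t -> y \in N x -> d y <= (d x).+1;
  par_step : forall x, x != r -> d x <= t ->
    x \in N (par x) /\ d x = (d (par x)).+1
}.

Fixpoint reach (T : finType) (N : T -> {set T}) (r : T) (i : nat) : {set T} :=
  if i is j.+1 then reach N r j :|: \bigcup_(x in reach N r j) N x else [set r].

Lemma reach_mono (T : finType) (N : T -> {set T}) (r : T) (i j : nat) :
  i <= j -> reach N r i \subset reach N r j.
Proof.
elim: j => [|j IHj]; first by rewrite leqn0 => /eqP->.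
rewrite leq_eqVlt => /predU1P[-> //|/IHj sub].
exact: subset_trans sub (subsetUl _ _).
Qed.

(** The depth of x is the first i <= t such that x is reached within i steps.
    The list [iota 0 t.+1] has size t.+1, so [find] returns t.+1 on the vertices
    out of reach. *)
Lemma layering_exists (T : finType) (N : T -> {set T}) (r : T) (t : nat) :
  exists d par, layering N r t d par.
Proof.
pose d x := find (fun i => x \in reach N r i) (iota 0 t.+1).
pose par x := odflt r [pick y | (x \in N y) && (d x == (d y).+1)].
have d_max x : d x <= t.+1 by rewrite -[t.+1](size_iota 0) find_size.
have dE i x : i <= t -> (d x <= i) = (x \in reach N r i).
  move=> it; apply/idP/idP => [dxi|xi].
    have dxt : d x < t.+1 by rewrite ltnS (leq_trans dxi).
    have hasx : has (fun i => x \in reach N r i) (iota 0 t.+1).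
      by rewrite has_find size_iota.
    have := nth_find 0 hasx; rewrite -/(d x) nth_iota // add0n.
    exact/subsetP/reach_mono.
  rewrite leqNgt; apply/negP => /(before_find 0).
  by rewrite nth_iota ?ltnS // add0n xi.
have d0 x : d x = 0 -> x = r.
  by move=> dx; have := dE 0 x isT; rewrite dx leqnn inE => /esym/eqP.
have dr : d r = 0 by apply/eqP; rewrite -leqn0 dE // inE.
have step x y : d x <= t -> y \in N x -> d y <= (d x).+1.
  move=> dxt yx; have [ltdx|ledx] := ltnP (d x) t; last first.
    by rewrite (leq_trans (d_max y)).
  rewrite dE //= inE; apply/orP; right; apply/bigcupP; exists x => //.
  by rewrite -dE.
exists d, par; split => //.
  by rewrite /par; case: pickP => //= y /andP[_]; rewrite dr.
move=> x xr dxt; rewrite /par; case: pickP => [y /andP[xy /eqP] //|no] /=.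
case dx: (d x) => [|j]; first by rewrite (d0 _ dx) eqxx in xr.
have jt : j < t by rewrite -dx.
have := dE j.+1 x jt; rewrite dx leqnn /= inE => /esym/orP[|/bigcupP[y]].
  by rewrite -dE ?(ltnW jt) // dx ltnn.
rewrite -dE ?(ltnW jt) // => yj xy.
have := no y; rewrite xy dx /= eqSS eqn_leq yj andbT.
have := step _ _ (leq_trans yj (ltnW jt)) xy.
by rewrite dx ltnS => ->.
Qed.

(** The depth of the neighbours is kept below t, while w may have depth t: a path
    of length at most t leads from the root through such a neighbour to w, and so
    p of these and the tree path to w use at most t (p + 1) edges. *)
Definition nontree (T : finType) (N : T -> {set T}) (t : nat) (d : T -> nat)
    (par : T -> T) (w : T) : {set T} :=
  [set y in N w | [&& d y < t, par y != w & par w != y]].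

Definition ancestors (T : finType) (d : T -> nat) (par : T -> T) (x : T) :
    {set T} := [set iter i par x | i : 'I_(d x).+1].

Section Layering.
Variables (T : finType) (N : T -> {set T}) (r : T) (t : nat).
Variables (d : T -> nat) (par : T -> T).
Hypothesis lay : layering N r t d par.

(** A tree path descends by one at each step, so that it meets the root exactly
    at step d x. *)
Lemma depth_iter_par (x : T) (i : nat) :
  d x <= t -> i <= d x -> d (iter i par x) = d x - i.
Proof.
move=> dxt; elim: i => [|i IHi] ix; first by rewrite subn0.
rewrite iterS; have IH := IHi (ltnW ix).
have nr : iter i par x != r.
  apply/eqP => E; move: IH; rewrite E (depth_root lay); lia.
have [|_] := par_step lay nr; first by rewrite IH; lia.
rewrite IH; lia.
Qed.

Lemma root_ancestors (x : T) : d x <= t -> r \in ancestors d par x.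
Proof.
move=> dxt; apply/imsetP; exists ord_max => //=.
by apply/esym/(depth_eq0 lay); rewrite depth_iter_par ?subnn.
Qed.

Lemma self_ancestors (x : T) : x \in ancestors d par x.
Proof. by apply/imsetP; exists ord0. Qed.

Lemma par_ancestors (x y : T) :
  d x <= t -> y \in ancestors d par x -> par y \in ancestors d par x.
Proof.
move=> dxt /imsetP[i _ ->].
have [ltix|] := ltnP i (d x).
  by apply/imsetP; exists (Ordinal (ltix : i.+1 < (d x).+1)).
move=> lexi; have -> : i = d x :> nat.
  by apply/eqP; rewrite eqn_leq lexi -ltnS ltn_ord.
have -> : iter (d x) par x = r.
  by apply: (depth_eq0 lay); rewrite depth_iter_par ?subnn.
by rewrite (par_root lay) root_ancestors.
Qed.

Lemma depth_ancestors (x y : T) :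
  d x <= t -> y \in ancestors d par x -> d y <= t.
Proof.
move=> dxt /imsetP[i _ ->]; rewrite depth_iter_par //; first lia.
by rewrite -ltnS.
Qed.

Lemma card_ancestors (x : T) :
  d x <= t -> #|ancestors d par x :\ r| <= d x.
Proof.
move=> dxt; have := leq_imset_card (fun i : 'I_(d x).+1 => iter i par x) 'I_(d x).+1.
by rewrite -/(ancestors d par x) (cardsD1 r) root_ancestors // card_ord.
Qed.

(** Two vertices with the same parent edge would be parents of each other, and
    then each would be deeper than the other. *)
Lemma par_edge_inj (x y : T) : x != r -> y != r -> d x <= t -> d y <= t ->
  [set x; par x] = [set y; par y] -> x = y.
Proof.
move=> xr yr xt yt E; have [_ dx] := par_step lay xr xt.
have [_ dy] := par_step lay yr yt.
have : x \in [set y; par y] by rewrite -E !inE eqxx.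
have : y \in [set x; par x] by rewrite E !inE eqxx.
rewrite !inE => /orP[/eqP-> //|/eqP yx] /orP[/eqP //|/eqP xy].
by exfalso; move: dx dy; rewrite -yx -xy; lia.
Qed.

End Layering.

Lemma depth_in (T : finType) (G : graph T) (S : {set T}) (r : T) (t : nat)
    (d : T -> nat) (par : T -> T) (x : T) :
  layering (nbr G S) r t d par -> r \in S -> d x <= t -> x \in S.
Proof.
move=> lay rS xt; have [->//|xr] := eqVneq x r.
by have [] := par_step lay xr xt; rewrite inE => /andP[].
Qed.

(** * Non-tree edges create subgraphs of prescribed excess *)

(** The subgraph spans the ancestors U of w and of A.  Its edges are the parent
    edges of U, one for each vertex other than r, and the p edges from w to A,
    which are distinct from them because they are non-tree edges. *)
Lemma nontree_subgraph (T : finType) (G : graph T) (S : {set T}) (r : T)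
    (t p : nat) (d : T -> nat) (par : T -> T) (w : T) (A : {set T}) :
  S \subset vset G -> r \in S -> layering (nbr G S) r t d par ->
  d w <= t -> A \subset nontree (nbr G S) t d par w -> #|A| = p -> 0 < p ->
  exists K : graph T, [/\ subgraph K G, #|eset K| + 1 = #|vset K| + p,
    p < #|eset K| & #|eset K| <= t * p.+1].
Proof.
move=> SV rS lay wt AN cA p0.
have AP a : a \in A -> [/\ a \in nbr G S w, d a < t, par a != w & par w != a].
  by move/(subsetP AN); rewrite inE => /andP[? /and3P[]].
have edgeP x : x != r -> d x <= t -> [set x; par x] \in eset G.
  by move=> xr xt; have [] := par_step lay xr xt; rewrite inE setUC => /andP[].
pose U := ancestors d par w :|: \bigcup_(a in A) ancestors d par a.
have UP x : x \in U -> exists2 a, (a == w) || (a \in A) & x \in ancestors d par a.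
  rewrite inE => /orP[xw|/bigcupP[a aA xa]]; first by exists w; rewrite ?eqxx.
  by exists a; rewrite ?aA ?orbT.
have aU a : (a == w) || (a \in A) -> ancestors d par a \subset U.
  move=> /orP[/eqP->|aA]; first exact: subsetUl.
  by rewrite /U subsetU // (bigcup_sup a) ?orbT.
have at_ a : (a == w) || (a \in A) -> d a <= t.
  by move=> /orP[/eqP->//|/AP[_ /ltnW]].
have Ut x : x \in U -> d x <= t.
  by move=> /UP[a /at_ dat] xa; apply: (depth_ancestors lay dat xa).
have Upar x : x \in U -> par x \in U.
  move=> /UP[a aw xa]; apply: (subsetP (aU _ aw)).
  exact: (par_ancestors lay (at_ _ aw) xa).
have rU : r \in U.
  by rewrite inE (root_ancestors lay).
have wU : w \in U by rewrite inE self_ancestors.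
have AU a : a \in A -> a \in U.
  by move=> aA; apply: (subsetP (aU a _)); rewrite ?aA ?orbT // self_ancestors.
pose E1 := [set [set x; par x] | x in U :\ r].
pose E2 := [set [set w; a] | a in A].
have E1G e : e \in E1 -> (e \in eset G) /\ e \subset U.
  move=> /imsetP[x /setD1P[xr xU] ->].
  split; first by rewrite edgeP ?Ut.
  by rewrite subUset !sub1set xU Upar.
have E2G e : e \in E2 -> (e \in eset G) /\ e \subset U.
  move=> /imsetP[a aA ->]; have [] := AP _ aA; rewrite inE => /andP[_ ->] _ _ _.
  by rewrite subUset !sub1set wU AU.
have E12G e : e \in E1 :|: E2 -> (e \in eset G) /\ e \subset U.
  by rewrite inE => /orP[/E1G|/E2G].
have KP e : e \in E1 :|: E2 -> #|e| = 2 /\ e \subset U.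
  by move=> /E12G[/esetP[]].
have cE1 : #|E1| = #|U|.-1.
  rewrite card_in_imset; first by rewrite (cardsD1 r U) rU.
  move=> x y /setD1P[xr xU] /setD1P[yr yU].
  by apply: (par_edge_inj lay); rewrite ?Ut.
have neqw a : a \in A -> a != w.
  move=> aA; apply/eqP => aw; have [] := AP _ aA.
  by rewrite aw (negPf (nbr_irrefl _ _ _)).
have cE2 : #|E2| = p.
  rewrite card_in_imset // => a b aA bA /setP/(_ a).
  by rewrite !inE eqxx orbT (negPf (neqw _ aA)) /= => /esym/eqP.
have dis : E1 :&: E2 = set0.
  apply/setP => e; rewrite in_set0; apply/negP => /setIP[].
  move=> /imsetP[x _ ->] /imsetP[a aA E]; have [_ _ aw wa] := AP _ aA.
  have : x \in [set w; a] by rewrite -E !inE eqxx.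
  have : a \in [set x; par x] by rewrite E !inE eqxx orbT.
  have : w \in [set x; par x] by rewrite E !inE eqxx.
  rewrite !inE => wx ax /orP[] /eqP xE; move: wx ax; rewrite xE.
    by rewrite (negPf (neqw _ aA)) /= [a == _]eq_sym (negPf wa).
  by rewrite [w == a]eq_sym (negPf (neqw _ aA)) /= [w == _]eq_sym (negPf aw).
have cE : #|E1 :|: E2| = #|U|.-1 + p by rewrite cardsU dis cards0 subn0 cE1 cE2.
have U2 : 1 < #|U|.
  have /card_gt0P[a aA] : 0 < #|A| by rewrite cA.
  rewrite (cardsD1 w U) wU ltnS; apply/card_gt0P; exists a.
  by rewrite !inE neqw // -in_setU AU.
have cU : #|U :\ r| <= t + p * t.-1.
  have -> : U :\ r = (ancestors d par w :\ r)
      :|: \bigcup_(a in A) (ancestors d par a :\ r).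
    apply/setP => x; rewrite !inE andb_orr; congr (_ || _).
    apply/andP/bigcupP => [[xr /bigcupP[a aA xa]]|[a aA]].
      by exists a; rewrite // !inE xr.
    by rewrite !inE => /andP[-> xa]; split => //; apply/bigcupP; exists a.
  apply: leq_trans (leq_card_setU _ _) _; apply: leq_add.
    exact: leq_trans (card_ancestors lay wt) wt.
  rewrite -cA -sum_nat_const.
  elim/big_rec2: _ => [|a m B aA IH]; first by rewrite cards0.
  apply: leq_trans (leq_card_setU _ _) _; apply: leq_add => //.
  have [_ dat _ _] := AP _ aA.
  by apply: leq_trans (card_ancestors lay (ltnW dat)) _; lia.
(* Needed for p * t.-1 + p = p * t in the bound on the number of edges. *)
have t0 : 0 < t.
  have /card_gt0P[a /AP[_ /(leq_ltn_trans (leq0n _)) ]] : 0 < #|A| by rewrite cA.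
  by [].
exists (Graph KP); split => /=; rewrite ?cE.
- split.
    by apply/subsetP => x xU; apply: (subsetP SV); apply: (depth_in lay rS); apply: Ut.
  by apply/subsetP => e /E12G[].
- lia.
- lia.
- move: cU; rewrite (cardsD1 r U) rU; nia.
Qed.

(** * Growth of the layers *)

Section Growth.
Variables (T : finType) (G : graph T) (S : {set T}) (r : T) (t p D : nat).
Variables (d : T -> nat) (par : T -> T).
Hypothesis lay : layering (nbr G S) r t d par.
Hypothesis rS : r \in S.
Hypothesis few_nontree :
  forall w, d w <= t -> #|nontree (nbr G S) t d par w| < p.

Let layer i := [set x | d x == i].

Lemma card_par_nontree (w : T) :
  d w <= t -> #|par w |: nontree (nbr G S) t d par w| <= p.
Proof.
move=> wt; apply: leq_trans (few_nontree wt).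
by rewrite cardsU1 -add1n leq_add2r leq_b1.
Qed.

Lemma child_depth (w y : T) :
  d y <= t -> y \in nbr G S w -> par y = w -> d y = (d w).+1.
Proof.
move=> yt yw wE; have [yr|yr] := eqVneq y r; last first.
  by have [_] := par_step lay yr yt; rewrite wE.
by move: yw; rewrite -wE yr (par_root lay) (negPf (nbr_irrefl _ _ _)).
Qed.

Let fresh w := nbr G S w :\: (par w |: nontree (nbr G S) t d par w).

(** Apart from par w and the non-tree neighbours, only two kinds of neighbours y
    of w are left: those of depth at least t and the children of w.  As y is at
    most one layer below w, it lies in the next layer in both cases. *)
Lemma fresh_depth (w y : T) : d w < t -> y \in fresh w ->
  d y = (d w).+1 /\ (d y < t -> par y = w).
Proof.
move=> wt /setDP[yw]; rewrite in_setU1 inE yw negb_or eq_sym => /andP[-> /=].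
have dy := depth_step lay (ltnW wt) yw; rewrite andbT negb_and negbK.
have [pyw _|_] := eqVneq (par y) w.
  by split=> //; apply: child_depth yw pyw; apply: leq_trans dy wt.
by rewrite orbF; lia.
Qed.

(** A neighbour of w in the previous layer cannot be a child of w.  By
    [card_par_nontree], at most p edges therefore lead back from w to that layer,
    including for w in the last layer, which is where this is applied. *)
Lemma down_cover (w : T) (i : nat) : d w = i.+1 -> i < t ->
  nbr G S w :&: layer i \subset par w |: nontree (nbr G S) t d par w.
Proof.
move=> dw it; apply/subsetP => y /setIP[yw]; rewrite inE => /eqP dy.
rewrite in_setU1 inE yw [par w == y]eq_sym dy it.
have [//|_ /=] := eqVneq y (par w); rewrite andbT.
have yt : d y <= t by rewrite dy ltnW.
by apply/eqP => /(child_depth yt yw); rewrite dy dw; lia.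
Qed.

Hypothesis min_degree : forall x, x \in S -> D + p <= #|nbr G S x|.

Lemma fresh_card (w : T) : d w <= t -> D <= #|fresh w|.
Proof.
move=> wt; rewrite -(leq_add2r p) (leq_trans (min_degree (depth_in lay rS wt))) //.
rewrite -(cardsID (par w |: nontree (nbr G S) t d par w) (nbr G S w)) addnC.
rewrite leq_add2l (leq_trans _ (card_par_nontree wt)) //.
exact/subset_leq_card/subsetIr.
Qed.

(** The fresh neighbours of distinct vertices are disjoint, as they have distinct
    parents. *)
Lemma layer_growth (i : nat) : i.+1 < t -> D * #|layer i| <= #|layer i.+1|.
Proof.
move=> it; rewrite mulnC -sum_nat_const.
apply: (@leq_trans (\sum_(w in layer i) #|[set y in layer i.+1 | par y == w]|)).
  apply: leq_sum => w; rewrite inE => /eqP dw.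
  have wt : d w < t by rewrite dw ltnW.
  rewrite (leq_trans (fresh_card (ltnW wt))) //.
  apply/subset_leq_card/subsetP => y yw; rewrite !inE.
  have [dy] := fresh_depth wt yw.
  by rewrite dy dw eqxx /= => /(_ it) ->.
rewrite -[leqRHS]sum1_card.
under eq_bigr do rewrite -sum1_card.
rewrite (exchange_big_dep (mem (layer i.+1))) /=; last first.
  by move=> w y _; rewrite inE => /andP[].
apply: leq_sum => y _; rewrite sum1dep_card.
rewrite -(cards1 (par y)); apply/subset_leq_card/subsetP => w.
by rewrite inE => /andP[_]; rewrite inE => /andP[_ /eqP->]; rewrite set11.
Qed.

(** In the last layer the fresh neighbourhoods may overlap: a vertex of depth t
    may have several neighbours of depth t - 1.  Counting the
    edges between the two layers from both sides costs the factor p. *)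
Lemma last_layer_growth : 0 < t -> D * #|layer t.-1| <= p * #|layer t|.
Proof.
move=> t0; rewrite mulnC -sum_nat_const.
apply: (@leq_trans (\sum_(w in layer t.-1) #|nbr G S w :&: layer t|)).
  apply: leq_sum => w; rewrite inE => /eqP dw.
  have wt : d w < t by rewrite dw prednK.
  rewrite (leq_trans (fresh_card (ltnW wt))) //.
  apply/subset_leq_card/subsetP => y yw; have [dy _] := fresh_depth wt yw.
  by move: yw => /setDP[yw _]; rewrite inE yw inE dy dw prednK ?eqxx.
under eq_bigr do rewrite -sum1_card.
rewrite (exchange_big_dep (mem (layer t))) /=; last by move=> w y _ /setIP[].
rewrite mulnC -sum_nat_const; apply: leq_sum => y; rewrite inE => /eqP dy.
have dyE : d y = t.-1.+1 by rewrite prednK.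
rewrite sum1dep_card (leq_trans _ (card_par_nontree (eq_leq dy))) //.
apply/subset_leq_card/(subset_trans _ (down_cover dyE _)); last by rewrite prednK.
apply/subsetP => w; rewrite inE => /andP[wl /setIP[yw _]].
rewrite inE wl andbT nbr_sym //; apply: (depth_in lay rS).
by move: wl; rewrite inE => /eqP ->; rewrite leq_pred.
Qed.

(** The inequality is strict because the root lies outside layer t. *)
Lemma layers_bound : 0 < t -> 0 < p -> D ^ t < p * #|S|.
Proof.
move=> t0 p0.
have pow i : i < t -> D ^ i <= #|layer i|.
  elim: i => [_|i IHi it].
    by rewrite card_gt0; apply/set0Pn; exists r; rewrite inE (depth_root lay).
  rewrite expnS (leq_trans _ (layer_growth it)) // leq_mul2l IHi ?orbT //.
  exact: ltnW.
apply: (@leq_ltn_trans (p * #|layer t|)).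
  rewrite -(prednK t0) expnS prednK // (leq_trans _ (last_layer_growth t0)) //.
  by rewrite leq_mul2l pow ?orbT // prednK.
rewrite ltn_pmul2l //; apply/proper_card/properP; split.
  by apply/subsetP => x; rewrite inE => /eqP xt; rewrite (depth_in lay) // xt.
by exists r => //; rewrite inE (depth_root lay) eq_sym -lt0n.
Qed.

End Growth.

(** * The extremal number *)

(** The hypothesis on the subgraphs K of G is what [free_of] yields for the family
    H2, with p for q + 2 and with t * p.+1 in place of the possibly larger k. *)
Lemma sparse_of_free (T : finType) (G : graph T) (p t D : nat) :
  0 < p -> 0 < t ->
  (forall K : graph T, subgraph K G -> #|eset K| + 1 = #|vset K| + p ->
    p < #|eset K| -> t * p.+1 < #|eset K|) ->
  p * #|vset G| <= D.+1 ^ t -> #|eset G| <= (D + p) * #|vset G|.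
Proof.
move=> p0 t0 nosub pn; rewrite leqNgt; apply/negP => /min_degree_subset.
case=> S [SV /set0Pn[r rS] degS].
have [d [par lay]] := layering_exists (nbr G S) r t.
have few w : d w <= t -> #|nontree (nbr G S) t d par w| < p.
  move=> wt; rewrite ltnNge; apply/negP => many.
  have [A AN cA] : exists2 A : {set T},
      A \subset nontree (nbr G S) t d par w & #|A| = p.
    move: many; set X := nontree _ _ _ _ _ => many.
    exists [set x in take p (enum X)].
      by apply/subsetP => x; rewrite inE => /mem_take; rewrite mem_enum.
    rewrite cardsE (card_uniqP _) ?take_uniq ?enum_uniq // size_takel //.
    by rewrite -cardE.
  have [K [KG KE Kp Kt]] := nontree_subgraph SV rS lay wt AN cA p0.
  by have := nosub K KG KE Kp; rewrite ltnNge Kt.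
have := layers_bound (D := D.+1) lay rS few degS t0 p0.
rewrite ltnNge (leq_trans _ pn) // leq_mul2l subset_leq_card ?orbT //.
Qed.

Local Open Scope ring_scope.

Lemma isomorphic_refl (T : finType) (G : graph T) : isomorphic G G.
Proof. by exists id; split => //; exists id. Qed.

Theorem theorem5 (R : realType) (q k : int) (n : nat)
    (hq : -1 <= q) (hk : 2 * q + 6 <= k) (hn : k <= n%:Z) :
  let t : R := (k %/ (q + 3))%Z%:~R in
  let C : R := (q + 2)%:~R `^ (1 / t) in
  (extremal n (H2 k q))%:R < C * n%:R `^ (1 + 1 / t) + (q + 2)%:~R * n%:R.
Proof.
have [p [p0 qE]] : exists p : nat, (0 < p)%N /\ q + 2 = p%:Z.
  by exists `|(q + 2)%R|%N; split; lia.
have [k' kE] : exists k' : nat, k = k'%:Z by exists `|k|%N; lia.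
pose s := (k' %/ p.+1)%N.
have sE : (k %/ (q + 3))%Z = s%:Z.
  by rewrite kE (_ : q + 3 = p.+1%:Z); [rewrite divz_nat|lia].
have s0 : (0 < s)%N by rewrite divn_gt0 //; lia.
have n0 : (0 < n)%N by lia.
rewrite sE qE /= !pmulrn.
(* D is the least natural number with p n <= (D + 1)^s. *)
have [D [Dlt Dge]] : exists D : nat, (D ^ s < p * n /\ p * n <= D.+1 ^ s)%N.
  have ex : exists j, (p * n <= j.+1 ^ s)%N.
    exists (p * n)%N; rewrite (leq_trans (leqnSn _)) //.
    by rewrite -[leqLHS]expn1 leq_pexp2l.
  case: (ex_minnP ex) => -[|j] jge jmin.
    by exists 0%N; rewrite exp0n // muln_gt0 p0.
  exists j.+1; split => //; rewrite ltnNge; apply/negP => /jmin; lia.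
have bound : (extremal n (H2 k q) <= (D + p) * n)%N.
  apply/bigmax_leqP => m /asboolP[T [G [GV GE free]]].
  rewrite -GE -GV; apply: (@sparse_of_free _ G p s) => //; last by rewrite GV.
  move=> K KG KE Kp; rewrite ltnNge; apply/negP => Kt.
  apply: (free T K); last by exists K; split => //; exact: isomorphic_refl.
  have sk : (s * p.+1 <= k')%N by exact: leq_trunc_div.
  by split; lia.
have rootD : D%:R < (p%:R * n%:R : R) `^ (1 / s%:R).
  rewrite -natrM.
  have -> : D%:R = ((D ^ s)%:R : R) `^ (1 / s%:R).
    by rewrite natrX -powR_mulrn // -powRrM mul1r divff ?powRr1 // pnatr_eq0 -lt0n.
  rewrite gt0_ltr_powR ?ltr_nat ?nnegrE ?ler0n //.
  by rewrite mul1r invr_gt0 ltr0n.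
have -> : p%:R `^ (1 / s%:R) * n%:R `^ (1 + 1 / s%:R)
    = (p%:R * n%:R) `^ (1 / s%:R) * n%:R :> R.
  rewrite powRD ?pnatr_eq0 -?lt0n ?n0 ?implybT // powRr1 // powRM //.
  by rewrite mulrCA mulrC.
apply: (@le_lt_trans _ _ (((D + p) * n)%:R)); first by rewrite ler_nat.
by rewrite natrM natrD mulrDl ltrD2r ltr_pM2r // ltr0n.
Qed.
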